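(* Let $g : U\times X\to X$ be a compactly driven system. Then $g$ has the unique solution property (USP) if and only if $g$ has the uniform attraction property (UAP).
   Context: A driven system consists of a metric space $(U,d_U)$ (input space), a compact metric space $(X,d)$ (state space) and a continuous map $g:U\times X\to X$. It is a compactly driven system if in addition $U$ is compact. Write $g_u(x):=g(u,x)$ and $\overline{U}:=\prod_{i\in\mathbb{Z}}U$ (bi-infinite sequences $\bar u=\{u_n\}_{n\in\mathbb{Z}}$). A solution of $g$ for input $\bar u\in\overline{U}$ is a bi-infinite sequence $\{x_n\}_{n\in\mathbb{Z}}$ in $X$ with $x_{n+1}=g(u_n,x_n)$ for all $n\in\mathbb{Z}$. The system $g$ has the unique solution property (USP) if for each $\bar u\in\overline{U}$ there exists exactly one solution. For $\bar u\in\overline U$, the process $\phi_{\bar u}$ is defined for integers $n\ge m$ and $x\in X$ by $\phi_{\bar u}(n,n,x)=x$ and $\phi_{\bar u}(n,m,x)=g_{u_{n-1}}\circ\cdots\circ g_{u_m}(x)$ for $m<n$. For $A\subset X$, $\phi_{\bar u}(n,m,A)$ denotes the image of $A$. Put $X_n(\bar u):=\bigcap_{m<n}\phi_{\bar u}(n,m,X)$. For nonempty closed $A,B\subset X$, $dist(A,B):=\inf\{\epsilon>0: A\subset B_\epsilon(B)\}$ is the Hausdorff semi-distance, where $B_\epsilon(B)=\{x\in X: d(x,B)<\epsilon\}$. A uniform point attractor of $\phi_{\bar u}$ is a sequence $\{A_n(\bar u)\}_{n\in\mathbb{Z}}$ of singleton subsets of $X$ with $A_n(\bar u)\subset X_n(\bar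 u)$, with $\phi_{\bar u}(n+1,n,A_n(\bar u))=A_{n+1}(\bar u)$ for all $n\in\mathbb{Z}$, and with $\lim_{j\to\infty}\sup_n dist(\phi_{\bar u}(n,n-j,X),A_n(\bar u))=0$ (equivalently $\lim_{j\to\infty}\sup_n dist(\phi_{\bar u}(n+j,n,X),A_{n+j}(\bar u))=0$). The system $g$ has the uniform attraction property (UAP) if for each $\bar u\in\overline{U}$ the process $\phi_{\bar u}$ has a uniform point attractor $\{A_k(\bar u)\}_{k\in\mathbb{Z}}$ and $$\lim_{j\to\infty}\ \sup_{k\in\mathbb{Z}}\ \sup_{\bar u\in\overline{U}}\ dist\big(\phi_{\bar u}(k,k-j,X),A_k(\bar u)\big)=0.$$ *)

(* Defs.v *)
From HB Require Import structures.
From mathcomp Require Import all_boot all_order all_algebra.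
From mathcomp Require Import all_classical all_reals all_analysis.

Set Implicit Arguments.
Unset Strict Implicit.
Unset Printing Implicit Defensive.

Import Order.TTheory GRing.Theory Num.Theory.
Import numFieldNormedType.Exports.

Local Open Scope classical_set_scope.
Local Open Scope ring_scope.

Section HausdorffSemiDistance.
Context {R : realType} {X : metricType R}.
Implicit Types (x : X) (A B : set X).

(* All infima and suprema are taken in R: they are only meaningful for bounded
   nonempty families. In a compact X this holds for every use below, since
   distances are bounded by the diameter and B is nonempty. The only empty
   family that can occur is the supremum over input sequences when U is empty,
   and then [sup set0 = 0], the supremum of the empty set in [0, +oo[. *)
Definition dist_to_set x B : R := inf [set mdist x b | b in B].

Definition set_nbhd (e : R) B : set X := [set x | dist_to_set x B < e].

Definition semidist A B : R := inf [set e : R | 0 < e /\ A `<=` set_nbhd e B].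

End HausdorffSemiDistance.

Section DrivenSystem.
Context {R : realType} {U X : metricType R}.
Implicit Types (g : U * X -> X) (u : int -> U) (x : X).

(* continuity is for the product topology on U * X *)
Definition driven_system g : Prop := compact [set: X] /\ continuous g.

Definition compactly_driven_system g : Prop :=
  driven_system g /\ compact [set: U].

Definition solution g u (s : int -> X) : Prop :=
  forall n : int, s (n + 1) = g (u n, s n).

Definition USP g : Prop := forall u, exists! s : int -> X, solution g u s.

Fixpoint flow g u (m : int) (k : nat) x : X :=
  if k is k'.+1 then g (u (m + k'%:Z), flow g u m k' x) else x.

(* only meaningful for m <= n, where [absz (n - m)] is the natural number n - m *)
Definition process g u (n m : int) x : X := flow g u m (absz (n - m)%R) x.

Lemma processnn g u n x : process g u n n x = x.
Proof. by rewrite /process subrr. Qed.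

Lemma processS g u n m x : m <= n ->
  process g u (n + 1) m x = g (u n, process g u n m x).
Proof.
rewrite -subr_ge0 /process => /gez0_abs nm.
have -> : absz (n + 1 - m)%R = (absz (n - m)%R).+1.
  by rewrite addrAC -nm -PoszD addn1.
by rewrite /= nm addrC subrK.
Qed.

(* the set X_n(u) *)
Definition limit_fiber g u (n : int) : set X :=
  \bigcap_(m in [set m : int | m < n]) (process g u n m @` [set: X]).

Record uniform_point_attractor g u (A : int -> set X) : Prop := {
  upa_singleton : forall n, exists a : X, A n = [set a] ;
  upa_fiber : forall n, A n `<=` limit_fiber g u n ;
  upa_invariant : forall n, process g u (n + 1) n @` A n = A (n + 1) ;
  upa_attracts :
    (fun j : nat =>
       sup [set semidist (process g u n (n - j%:Z) @` [set: X]) (A n)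
           | n in [set: int]]) @ \oo --> (0 : R) }.

Definition UAP g : Prop :=
  exists A : (int -> U) -> int -> set X,
    (forall u, uniform_point_attractor g u (A u)) /\
    (fun j : nat =>
       sup [set sup [set semidist (process g u k (k - j%:Z) @` [set: X]) (A u k)
                    | u in [set: int -> U]]
           | k in [set: int]]) @ \oo --> (0 : R).

End DrivenSystem.

(* Main.v *)
Require Import Defs.
From mathcomp Require Import all_boot all_order all_algebra.
From mathcomp Require Import all_classical all_reals all_analysis.
From mathcomp Require Import lra.

(** Why USP and UAP are equivalent.

    From uniqueness to uniform attraction. Call [y] a forward orbit from time
    [m] if it obeys the dynamics at all times [n >= m]. If attraction were not
    uniform at some scale [e > 0], then for every [J] there would be an input
    and two forward orbits from time [-J] whose states at time 0 are at
    distance at least [e]. For fixed [J] the triples (input, orbit, orbit) with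
    this property form a closed subset of the space of sequences in
    [U * X * X], which is compact by Tychonoff's theorem, and these subsets
    decrease with [J]. A common point of all of them is an input with two
    solutions that differ at time 0, against uniqueness. Hence a single [J]
    works for all inputs at once ([uniform_merging]). Shifting the input carries
    this from time 0 to every time, and applying it to a trajectory of the
    process and to the solution shows that the points of the solution form a
    uniform point attractor, with a rate independent of input and time
    ([USP_UAP]).

    From attraction to uniqueness. Invariance of the singletons [A_n] says
    precisely that their points form a solution. The state at time [n] of any
    other solution lies in the image of [X] under the process from time [n - j]
    to time [n], for every [j]; hence its distance to the point of [A_n] is at
    most the semidistance of that image to [A_n], which tends to 0
    ([attractor_solution_unique]).

    Suprema and infima are taken in the reals, where an unbounded family has
    supremum 0, so the second argument needs the semidistances to be bounded;
    this is what the finite diameter of [X] is for ([compact_diameter]). *)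

Set Implicit Arguments.
Unset Strict Implicit.
Unset Printing Implicit Defensive.

Import Order.TTheory GRing.Theory Num.Theory.
Import numFieldNormedType.Exports.

Local Open Scope classical_set_scope.
Local Open Scope ring_scope.

(** * Metric spaces and compactness *)

Lemma mdist_continuous (R : realType) (X : metricType R) :
  continuous (fun p : X * X => mdist p.1 p.2 : R).
Proof.
move=> [x y]; apply/cvgrPdist_le => e e0 /=.
exists (ball x (e / 2), ball y (e / 2)).
  by split; apply: nbhsx_ballx; rewrite divr_gt0.
move=> [x' y'] [] /=; rewrite !ballEmdist /= => xx' yy'.
have e2 : e = e / 2 + e / 2 by exact: splitr.
have := metric_triangle x x' y; have := metric_triangle x' y' y.
have := metric_triangle x' x y'; have := metric_triangle x y y'.
rewrite (metric_sym x' x) (metric_sym y' y) ler_norml.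
by move=> *; apply/andP; split; lra.
Qed.

Lemma continuous_mdist (R : realType) (X : metricType R) (T : topologicalType)
    (f h : T -> X) : continuous f -> continuous h ->
  continuous (fun w => mdist (f w) (h w) : R).
Proof.
move=> cf ch w.
apply: (@continuous_comp _ _ _ (fun w => (f w, h w))
  (fun p : X * X => mdist p.1 p.2 : R)); last exact: mdist_continuous.
by apply: cvg_pair; [exact: cf|exact: ch].
Qed.

Lemma closed_equalizer (R : realType) (X : metricType R) (T : topologicalType)
    (f h : T -> X) : continuous f -> continuous h ->
  closed [set w | f w = h w].
Proof.
move=> cf ch.
rewrite (_ : [set _ | _] = (fun w => mdist (f w) (h w) : R) @^-1` [set 0]).
  apply: preimage_closed; last exact: closed_eq.
  by move=> w _; exact: continuous_mdist.
apply/seteqP; split => w /= => [->|]; first exact: mdistxx.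
exact: mdist_positivity.
Qed.

Lemma compact_diameter (R : realType) (X : metricType R) :
  compact [set: X] -> exists2 D : R, 0 < D & forall x y : X, mdist x y < D.
Proof.
move=> cX; have cXX : compact [set: X * X].
  by rewrite -setXTT; exact: compact_setX.
have [XX0|/set0P XX0] := eqVneq [set: X * X] set0.
  by exists 1 => // x y; have : set0 (x, y) by rewrite -XX0.
have [|D _ Dmax] := compact_EVT_max (f := fun p : X * X => mdist p.1 p.2 : R)
  XX0 cXX.
  by apply: continuous_subspaceT; exact: mdist_continuous.
exists (mdist D.1 D.2 + 1); first by rewrite ltr_wpDl // mdist_ge0.
by move=> x y; rewrite ltr_pwDr //; apply: (Dmax (x, y)); rewrite inE.
Qed.

(** Pick a point in each set; a cluster point of this sequence lies in the
    closure of every [F i], because the sequence is eventually in [F i]. *)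
Lemma compact_decreasing_meet (T : topologicalType) (F : nat -> set T) :
  compact [set: T] -> (forall i, closed (F i)) ->
  (forall i j, (i <= j)%N -> F j `<=` F i) -> (forall i, F i !=set0) ->
  exists p, forall i, F i p.
Proof.
move=> cT clF decF /choice[w Fw].
have [|p [_ clp]] := cT (w @ \oo) _; first exact: filterT.
exists p => i; apply: clF => B /(clp (F i)); apply.
by exists i => // j /= /decF; apply.
Qed.

(** * Semidistance to a singleton *)

Section SemiDistance.
Context {R : realType} {X : metricType R}.
Implicit Types (A : set X) (b : X) (e : R).

Lemma set_nbhd1 e b : set_nbhd e [set b] = [set x | mdist x b < e].
Proof.
rewrite /set_nbhd /dist_to_set.
by under eq_fun do rewrite image_set1 inf1.
Qed.

Lemma semidist_ge0 A B : 0 <= semidist A B.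
Proof.
rewrite /semidist; set E := [set _ | _].
have [->|E0] := eqVneq E set0; first by rewrite inf0.
by apply: lb_le_inf; [exact/set0P|move=> e [/ltW]].
Qed.

(** The strict hypothesis lets [e] itself belong to the set whose infimum is the
    semidistance. *)
Lemma semidist1_le A b e : 0 < e -> (forall a, A a -> mdist a b < e) ->
  semidist A [set b] <= e.
Proof.
move=> e0 Ae; apply: ge_inf; first by exists 0 => r [/ltW].
by split => // a Aa; rewrite set_nbhd1; exact: Ae.
Qed.

(** Without compactness the set of admissible radii could be empty and the
    semidistance would then be 0 by convention; a bound on the diameter provides
    an admissible radius. *)
Lemma mdist_le_semidist1 A b a :
  compact [set: X] -> A a -> mdist a b <= semidist A [set b].
Proof.
move=> /compact_diameter[D D0 ltD] Aa; apply: lb_le_inf.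
  by exists D; split=> // x _; rewrite set_nbhd1; exact: ltD.
by move=> e [_]; rewrite set_nbhd1 => /(_ _ Aa)/ltW.
Qed.

End SemiDistance.

(** Nonnegativity of [e] covers the empty family, whose supremum is 0; this
    occurs when there are no inputs. *)
Lemma sup_itv (R : realType) (S : set R) (e : R) :
  0 <= e -> (forall x, S x -> 0 <= x <= e) -> 0 <= sup S <= e.
Proof.
move=> e0 Se; have [->|/set0P S0] := eqVneq S set0; first by rewrite sup0 lexx.
apply/andP; split; last by apply: ge_sup => // x /Se /andP[].
have [x Sx] := S0; apply: (@le_trans _ _ x); first by have /andP[] := Se _ Sx.
by apply: ub_le_sup => //; exists e => y /Se /andP[].
Qed.

(** * Forward orbits *)

Section Orbits.
Context {R : realType} {U X : metricType R}.
Variable g : U * X -> X.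
Implicit Types (u : int -> U) (s y z : int -> X).

(** A constraint on [s] at the times [n >= m] only: the entries before time [m]
    are free. Keeping the index set all of [int] makes the forward orbits from
    different starting times subsets of one and the same product space. *)
Definition orbit_from u (m : int) s :=
  forall n, m <= n -> s (n + 1) = g (u n, s n).

(** The values of the process at times before [m] are meaningless, but a forward
    orbit from [m] does not constrain them. *)
Lemma process_orbit_from u m x : orbit_from u m (fun n => process g u n m x).
Proof. by move=> n mn; exact: processS. Qed.

Lemma orbit_from_process u m s n : orbit_from u m s -> m <= n ->
  process g u n m (s m) = s n.
Proof.
move=> us; rewrite -subr_ge0 => mn.
have -> : n = m + (absz (n - m))%:Z by rewrite gez0_abs // subrKC.
elim: (absz (n - m)) => [|k IH]; first by rewrite addr0 processnn.
have mk : m <= m + k%:Z by rewrite lerDl.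
by rewrite -addn1 PoszD addrA us // processS // IH.
Qed.

Lemma solution_orbit_from u s m : solution g u s -> orbit_from u m s.
Proof. by move=> us n _; exact: us. Qed.

Lemma solution_in_image u s n m : solution g u s -> m <= n ->
  (process g u n m @` [set: X]) (s n).
Proof.
move=> us mn; exists (s m) => //.
by apply: orbit_from_process => //; exact: solution_orbit_from.
Qed.

Lemma closed_orbit_from (T : topologicalType) (v : T -> int -> U)
    (y : T -> int -> X) (m : int) : continuous g ->
  (forall n, continuous (v ^~ n)) -> (forall n, continuous (y ^~ n)) ->
  closed [set w | orbit_from (v w) m (y w)].
Proof.
move=> contg cv cy.
rewrite (_ : [set _ | _] = \bigcap_(n in [set n | m <= n])
    [set w | y w (n + 1) = g (v w n, y w n)]); last first.
  by apply/seteqP; split => w.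
apply: closed_bigI => n _; apply: closed_equalizer; first exact: cy.
move=> w; apply: (@continuous_comp _ _ _ (fun w => (v w n, y w n)) g).
  by apply: cvg_pair; [exact: cv|exact: cy].
exact: contg.
Qed.

(** * The two implications *)

Hypothesis cg : compactly_driven_system g.

(** The core of the theorem: uniqueness of full solutions, a statement about an
    infinite past, is turned by compactness into a quantitative statement about
    a past of length [J], with [J] independent of the input. *)
Lemma uniform_merging :
  (forall u y z, solution g u y -> solution g u z -> y = z) ->
  forall e : R, 0 < e -> exists J : nat, forall u y z,
    orbit_from u (- J%:Z) y -> orbit_from u (- J%:Z) z -> mdist (y 0) (z 0) < e.
Proof.
move=> uniq e e0; apply: contrapT => noJ.
have [[cX contg] cU] := cg.
(* a point of [T] bundles an input with two candidate orbits for it *)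
pose T := prod_topology (fun _ : int => (U * X * X)%type).
have cT : compact [set: T].
  have := @tychonoff int (fun=> (U * X * X)%type) (fun=> setT).
  rewrite (_ : [set f | _] = setT); last by rewrite -subTset => f.
  by apply => _; rewrite -!setXTT; do 2?apply: compact_setX.
have cont_coord n (Y : topologicalType) (h : U * X * X -> Y) :
    continuous h -> continuous (fun w : T => h (w n)).
  move=> ch w; apply: (@continuous_comp _ _ _ (fun w : T => w n) h).
    exact: proj_continuous.
  exact: ch.
have contu n : continuous (fun w : T => (w n).1.1).
  apply: (cont_coord n _ (fun p => p.1.1)) => p.
  by apply: (@continuous_comp _ _ _ fst fst); exact: cvg_fst.
have conty n : continuous (fun w : T => (w n).1.2).
  apply: (cont_coord n _ (fun p => p.1.2)) => p.
  by apply: (@continuous_comp _ _ _ fst snd); [exact: cvg_fst|exact: cvg_snd].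
have contz n : continuous (fun w : T => (w n).2).
  by apply: (cont_coord n _ snd) => p; exact: cvg_snd.
pose F (J : nat) := [set w : T |
  [/\ orbit_from (fun n => (w n).1.1) (- J%:Z) (fun n => (w n).1.2),
      orbit_from (fun n => (w n).1.1) (- J%:Z) (fun n => (w n).2) &
      e <= mdist (w 0).1.2 (w 0).2]].
have [J|i j ij w [oy oz ew]|J|w Fw] := @compact_decreasing_meet T F cT.
- rewrite (_ : F J = [set w : T | orbit_from (fun n => (w n).1.1) (- J%:Z)
        (fun n => (w n).1.2)]
    `&` [set w : T | orbit_from (fun n => (w n).1.1) (- J%:Z)
        (fun n => (w n).2)]
    `&` (fun w : T => mdist (w 0).1.2 (w 0).2 : R) @^-1` [set r | e <= r]).
    apply: closedI; first apply: closedI.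
    + exact: (closed_orbit_from (v := fun (w : T) n => (w n).1.1)
        (y := fun (w : T) n => (w n).1.2)).
    + exact: (closed_orbit_from (v := fun (w : T) n => (w n).1.1)
        (y := fun (w : T) n => (w n).2)).
    + apply: preimage_closed; last exact: closed_ge.
      by move=> w _; apply: continuous_mdist; [exact: conty|exact: contz].
  by apply/seteqP; split => w /= => [[]|[[]]].
- have ji : - j%:Z <= - i%:Z by rewrite lerN2 lez_nat.
  by split => // n jn; [apply: oy|apply: oz]; exact: le_trans jn.
- apply: contrapT => FJ; apply: noJ; exists J => u y z oy oz.
  rewrite ltNge; apply/negP => eyz; apply: FJ.
  by exists (fun n => (u n, y n, z n)); split.
(* each time [n] is eventually covered, already by [J = |n|] *)
have sol (v : int -> X) :
    (forall J : nat, orbit_from (fun n => (w n).1.1) (- J%:Z) v) ->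
    solution g (fun n => (w n).1.1) v.
  move=> ov n; apply: (ov (absz n)); rewrite lerNl.
  apply: le_trans (ler_norm _) _.
  by rewrite normrN abszE.
(* the two solutions in [w] coincide, but are [e] apart at time 0 *)
have [_ _] := Fw 0%N; rewrite leNgt => /negP; apply.
have yz : (fun n => (w n).1.2) = (fun n => (w n).2).
  by apply: uniq (fun n => (w n).1.1) _ _ _ _; apply: sol => J; have [] := Fw J.
by rewrite (congr1 (fun f => f 0) yz) mdistxx.
Qed.

Lemma USP_UAP : USP g -> UAP g.
Proof.
move=> usp; have [s s_uniq] := choice usp.
have sol u : solution g u (s u) by have [] := s_uniq u.
have unif (e : R) : 0 < e -> \forall j \near \oo, forall u k,
    0 <= semidist (process g u k (k - j%:Z) @` [set: X]) [set s u k] <= e.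
  move=> e0; have [|J HJ] := uniform_merging _ e0.
    move=> u y z uy uz; have [_ us] := s_uniq u.
    by rewrite -(us _ uy) (us _ uz).
  exists J => // j /= Jj u k; rewrite semidist_ge0 /=.
  apply: semidist1_le => // _ [x _ <-].
  (* shift time by [k], so that time [k] becomes time 0 *)
  have := HJ (fun n => u (n + k)) (fun n => process g u (n + k) (k - j%:Z) x)
    (fun n => s u (n + k)); rewrite !add0r; apply => n Jn.
    have kj : k - j%:Z <= n + k.
      by rewrite addrC lerD2r; apply: le_trans Jn; rewrite lerN2 lez_nat.
    by rewrite addrAC processS.
  by rewrite addrAC; exact: sol.
exists (fun u n => [set s u n]); split => [u|]; first split.
- by move=> n; exists (s u n).
- by move=> n _ -> m /= /ltW; exact: solution_in_image.
- by move=> n; rewrite image_set1 processS // processnn sol.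
- apply/cvgr0Pnorm_le => e e0; near=> j.
  have : 0 <= sup [set semidist (process g u n (n - j%:Z) @` [set: X])
       [set s u n] | n in [set: int]] <= e.
    apply: sup_itv (ltW e0) _ => _ [n _ <-]; move: u n; near: j; exact: unif.
  by case/andP => ? ?; rewrite ger0_norm.
- apply/cvgr0Pnorm_le => e e0; near=> j.
  have : 0 <= sup [set sup [set semidist (process g u k (k - j%:Z) @` [set: X])
       [set s u k] | u in [set: int -> U]] | k in [set: int]] <= e.
    apply: sup_itv (ltW e0) _ => _ [k _ <-].
    apply: sup_itv (ltW e0) _ => _ [u _ <-]; move: u k; near: j; exact: unif.
  by case/andP => ? ?; rewrite ger0_norm.
Unshelve. all: by end_near. Qed.

Lemma attractor_solution_unique u (A : int -> set X) :
  uniform_point_attractor g u A -> exists! s, solution g u s.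
Proof.
move=> [Asing _ Ainv Aattr]; have [[cX _] _] := cg.
have [s As] := choice Asing; exists s; split => [n|s' us'].
  have : (process g u (n + 1) n @` A n) (process g u (n + 1) n (s n)).
    by exists (s n) => //; rewrite As.
  by rewrite Ainv As processS // processnn => /= ->.
apply/funext => n; apply/esym/mdist_positivity/eqP.
rewrite eq_le mdist_ge0 andbT; apply/ler_addgt0Pl => e e0; rewrite addr0.
have /cvgr0Pnorm_le/(_ e e0)[j _ /(_ j (leqnn j)) /=] := Aattr.
apply: le_trans; apply: le_trans (ler_norm _).
apply: (@le_trans _ _ (semidist (process g u n (n - j%:Z) @` [set: X]) (A n))).
  rewrite As; apply: mdist_le_semidist1 => //.
  by apply: solution_in_image; rewrite // gerBl.
(* the supremum bounds its members only if the family is bounded *)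
have [D D0 ltD] := compact_diameter cX.
apply: ub_le_sup; last by exists n.
by exists D => _ [k _ <-]; rewrite As; apply: semidist1_le.
Qed.

End Orbits.

Theorem theorem1 (R : realType) (U X : metricType R) (g : U * X -> X) :
  compactly_driven_system g -> (USP g <-> UAP g).
Proof.
move=> cg; split; first exact: USP_UAP.
by move=> [A [upaA _]] u; exact: attractor_solution_unique (upaA u).
Qed.
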